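(* Let $\mathbb{D}$ be a countable set, $(M,+)$ a commutative monoid, $V$ a finite set of data vectors $\mathbb{D}\to M$, and $\vec{x}$ a data vector. If $\vec{x}$ is a permutation sum of $V$, then $\vec{x}=\sum_{\vec{v}\in V}\mathrm{eval}(\vec{v},H_{\vec{v}})$ where for each $\vec{v}\in V$, $H_{\vec{v}}$ is a histogram over $\mathrm{supp}(\vec{v})$, and $$\Big|\bigcup_{\vec{v}\in V}\mathrm{supp}(H_{\vec{v}})\Big|\le|\mathrm{supp}(\vec{x})|+1+\sum_{\vec{v}\in V}\big(2|\mathrm{supp}(\vec{v})|-1\big).$$
   Context: A data vector is a function $\vec{v}:\mathbb{D}\to M$ with finite support $\mathrm{supp}(\vec{v})=\{\alpha\mid\vec{v}(\alpha)\neq0\}$; addition is pointwise. $\vec{x}$ is a permutation sum of $V$ if $\vec{x}=\sum_{i=1}^n\vec{v_i}\circ\theta_i$ for some $n\in\mathbb{N}$, $\vec{v_i}\in V$ (repetitions allowed) and permutations $\theta_i$ of $\mathbb{D}$. A histogram over a finite $S\subseteq\mathbb{D}$ is a function $H:S\times\mathbb{D}\to\mathbb{N}$ such that for some $n\in\mathbb{N}$, $\sum_{\beta\in\mathbb{D}}H(\alpha,\beta)=n$ for all $\alpha\in S$ and $\sum_{\alpha\in S}H(\alpha,\beta)\le n$ for all $\beta\in\mathbb{D}$; its support is $\mathrm{supp}(H)=\{\beta\mid\sum_{\alpha\in S}H(\alpha,\beta)>0\}$. For a histogram $H$ over $\mathrm{supp}(\vec{v})$, $\mathrm{eval}(\vec{v},H)(\beta)=\sum_{\alpha\in\mathrm{supp}(\vec{v})}H(\alpha,\beta)\cdot\vec{v}(\alpha)$.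 *)

(* Defs.v *)
From HB Require Import structures.
From mathcomp Require Export all_boot all_order all_algebra.
From mathcomp Require Export finmap.

Set Implicit Arguments.
Unset Strict Implicit.
Unset Printing Implicit Defensive.

Import GRing.Theory.
Local Open Scope fset_scope.
Local Open Scope ring_scope.

Notation dataVector D M := {fsfun D -> M with (0 : M)%R}.

(* [v i \o theta i] need not be rebuilt as a finitely supported function: the
   sum of vectors is pointwise, so the equation is stated at every datum. *)
Definition permutation_sum (D : countType) (M : nmodType)
    (V : {fset dataVector D M}) (x : dataVector D M) : Prop :=
  exists (n : nat) (v : 'I_n -> dataVector D M) (theta : 'I_n -> D -> D),
    [/\ forall i, v i \in V,
        forall i, bijective (theta i)
      & forall b, x b = \sum_(i < n) v i (theta i b)].

(* Functions S x D -> nat. Finite support loses nothing: S is finite, and a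
   family of natural numbers indexed by D whose sum is some n : nat has only
   finitely many nonzero terms. *)
Notation histFun S D := {fsfun (S * D)%type -> nat with 0%N}.

Definition col_sum (D : countType) (S : {fset D}) (H : histFun S D) (b : D) :
    nat :=
  (\sum_(a : S) H (a, b))%N.

(* See [in_hist_supp]; the outer set only makes the comprehension finite. *)
Definition hist_supp (D : countType) (S : {fset D}) (H : histFun S D) :
    {fset D} :=
  [fset b in [fset p.2 | p in finsupp H] | (0 < col_sum H b)%N].

(* The sum over all b : D, as the terms outside [hist_supp H] are zero; see
   [row_sumE]. *)
Definition row_sum (D : countType) (S : {fset D}) (H : histFun S D) (a : S) :
    nat :=
  (\sum_(b <- hist_supp H) H (a, b))%N.

Definition is_histogram (D : countType) (S : {fset D}) (H : histFun S D) :
    Prop :=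
  exists n : nat, (forall a : S, row_sum H a = n) /\
                  (forall b : D, (col_sum H b <= n)%N).

Definition eval (D : countType) (M : nmodType) (v : dataVector D M)
    (H : histFun (finsupp v) D) (b : D) : M :=
  \sum_(a : finsupp v) v (val a) *+ H (a, b).

Lemma in_hist_supp (D : countType) (S : {fset D}) (H : histFun S D) (b : D) :
  (b \in hist_supp H) = (0 < col_sum H b)%N.
Proof.
rewrite !inE /=; apply/andP/idP => [[]//|Hb]; split=> //.
move: Hb; rewrite lt0n sum_nat_eq0 negb_forall => /existsP[a Ha].
by apply/imfsetP; exists (a, b) => //=; rewrite mem_finsupp.
Qed.

Lemma row_sumE (D : countType) (S : {fset D}) (H : histFun S D) (a : S)
    (B : {fset D}) :
  (forall b, b \notin B -> H (a, b) = 0%N) ->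
  row_sum H a = (\sum_(b <- B) H (a, b))%N.
Proof.
move=> HB; rewrite /row_sum.
have H0 b : b \notin hist_supp H -> H (a, b) = 0%N.
  rewrite in_hist_supp lt0n negbK sum_nat_eq0 => /forallP/(_ a).
  by move/eqP.
rewrite (big_fsetID _ (mem B)) /= [X in (_ + X)%N]big1_fset ?addn0; last first.
  by move=> b; rewrite !inE => /andP[_ /HB].
rewrite [RHS](big_fsetID _ (mem (hist_supp H))) /=.
rewrite [X in _ = (_ + X)%N]big1_fset ?addn0; last first.
  by move=> b /imfsetP[c /= /andP[_ Hc] ->] _; apply: H0.
by apply: eq_fbigl => b; rewrite !inE /= andbC.
Qed.

(* Main.v *)
Require Import Defs.
From mathcomp Require Import all_boot all_order all_algebra finmap.
From mathcomp Require Import zify.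

Import Order.TTheory GRing.Theory Num.Theory.

Local Open Scope fset_scope.
Local Open Scope ring_scope.

(* Counting how often each datum is sent to each element of a support turns the
   permutation sum into histograms H_v. Two columns b, c outside supp(x) can be
   merged (both evaluate to 0, hence so does their sum) unless the column bound
   n_v of some histogram would be exceeded. Suppose no two columns of a set C
   can be merged; the columns of H_v add up to |supp(v)| n_v. If every b in C
   has a column larger than n_v / 2 for some v, then |C| is at most the sum of
   the 2 |supp(v)| - 1. Otherwise some c in C has only columns of size at most
   n_v / 2, and as every other b conflicts with c for some v, |C| - 1 is at most
   the sum of the 2 |supp(v)| - 2. Hence the bound holds with 2 |supp(v)| - 1
   summed over the nonzero v only. *)

Lemma leq_card_bigfcup (I : Type) (K : choiceType) (r : seq I)
    (F : I -> {fset K}) :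
  (#|` \bigcup_(i <- r) F i| <= \sum_(i <- r) #|` F i|)%N.
Proof.
elim: r => [|i r IH]; first by rewrite !big_nil cardfs0.
rewrite !big_cons cardfsU (leq_trans (leq_subr _ _)) //.
by rewrite leq_add2l.
Qed.

(** Markov's inequality in counting form; it bounds the sets of large columns below. *)
Lemma sum_fset_const_leq (K : choiceType) (A C : {fset K}) (k : nat)
    (f : K -> nat) :
  A `<=` C -> {in A, forall b, (k <= f b)%N} ->
  (#|` A| * k <= \sum_(b <- C) f b)%N.
Proof.
move=> sAC kf; apply: (@leq_trans (\sum_(b <- A) f b)%N).
  rewrite mulnC -sum1_size big_distrr /= !big_seq.
  by apply: leq_sum => b bA; rewrite muln1 kf.
rewrite [X in (_ <= X)%N](big_fsetID _ (mem A)) /=.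
rewrite (_ : [fset _ | _ in _ & _] = A) ?leq_addr //.
apply/fsetP => b; rewrite !inE /= andbC.
by case: (boolP (b \in A)) => //= /(fsubsetP sAC).
Qed.

(** Pigeonhole applied twice: the sets [T w] of columns above half of [n w] cannot cover [C], which
    leaves some [c]; the sets [U w] of columns in conflict with [c] cannot cover the rest, which
    leaves some [b]. Here [s w] stands for the number of rows and [n w] for the common row sum. *)
Lemma exists_mergeable (I : eqType) (K : choiceType) (W : seq I) (C : {fset K})
    (s n : I -> nat) (col : I -> K -> nat) :
  W != [::] ->
  {in W, forall w, (0 < s w)%N} ->
  {in W, forall w, (\sum_(b <- C) col w b <= s w * n w)%N} ->
  (\sum_(w <- W) (2 * s w).-1 < #|` C|)%N ->
  exists b c, [/\ b \in C, c \in C, b != c &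
    {in W, forall w, (col w b + col w c <= n w)%N}].
Proof.
move=> W0 s_gt0 sumC ltC.
pose T w := [fset b in C | (n w < 2 * col w b)%N].
have cardT w : w \in W -> (#|` T w| <= (2 * s w).-1)%N.
  move=> wW.
  have TC : T w `<=` C by apply/fsubsetP => b; rewrite !inE => /andP[].
  have := @sum_fset_const_leq _ _ _ (n w).+1 (fun b => 2 * col w b)%N TC.
  rewrite -big_distrr /= => /(_ _)/wrap[].
    by move=> b; rewrite !inE => /andP[].
  (* [(n + 1) |T| <= 2 s n < 2 s (n + 1)], hence [|T| < 2 s]. *)
  by have := sumC w wW; have := s_gt0 w wW; nia.
have /fsubsetPn[c cC cT] : ~~ (C `<=` \bigcup_(w <- W) T w).
  apply/negP => /fsubset_leq_card; apply/negP; rewrite -ltnNge.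
  apply: leq_ltn_trans (leq_card_bigfcup _ _ _ _) _; apply: leq_ltn_trans ltC.
  by rewrite !big_seq; apply: leq_sum.
have light w : w \in W -> (2 * col w c <= n w)%N.
  move=> wW; rewrite leqNgt; apply: contra cT => ltc.
  by apply/bigfcupP; exists w; rewrite ?wW // !inE /= cC.
pose U w := [fset b in C `\ c | (n w < col w b + col w c)%N].
have cardU w : w \in W -> (#|` U w| < (2 * s w).-1)%N.
  move=> wW.
  have UC : U w `<=` C `\ c by apply/fsubsetP => b; rewrite !inE => /andP[].
  have := @sum_fset_const_leq _ _ _ ((n w).+1 - col w c)%N (col w) UC.
  move=> /(_ _)/wrap[]; first by move=> b; rewrite !inE => /andP[_]; lia.
  (* With [t = col w c], [|U| (n + 1 - t) <= s n - t], whereas [2 t <= n] gives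
     [(2 s - 1) (n + 1 - t) > s n - t]. *)
  have := sumC w wW; rewrite (big_fsetD1 c) //=.
  by have := s_gt0 w wW; have := light w wW; nia.
have /fsubsetPn[b bC bU] : ~~ (C `\ c `<=` \bigcup_(w <- W) U w).
  apply/negP => /fsubset_leq_card; apply/negP; rewrite -ltnNge.
  apply: leq_ltn_trans (leq_card_bigfcup _ _ _ _) _.
  have := cardfsD1 c C; rewrite cC /= => cardC.
  (* Removing [c] costs one element of [C]; the strict bound on [U w] for the head of the nonempty
     [W] makes up for it. *)
  suff : (\sum_(w <- W) #|` U w| < \sum_(w <- W) (2 * s w).-1)%N by lia.
  case: W W0 cardU {s_gt0 sumC ltC cardT cT light} => // w W _ cardU.
  rewrite !big_cons -addSn leq_add ?cardU ?mem_head // !big_seq.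
  by apply: leq_sum => w' w'W; apply/ltnW/cardU; rewrite inE w'W orbT.
exists b, c; move: bC; rewrite !inE => /andP[bc bC]; split=> // w wW.
rewrite leqNgt; apply: contra bU => ltn.
by apply/bigfcupP; exists w; rewrite ?wW // !inE /= bc bC.
Qed.

Section Decomposition.

Context {D : countType} {M : nmodType}.
Variables (V : {fset dataVector D M}) (x : dataVector D M).

(** Histograms with plain functions as entries and one finite set [B] containing all their columns,
    so that columns can be edited by case distinction. *)
Record hist_decomposition (B : {fset D})
    (h : forall v : dataVector D M, finsupp v -> D -> nat)
    (n : dataVector D M -> nat) : Prop := HistDecomposition {
  hist_out : forall v a b, v \in V -> b \notin B -> h v a b = 0%N;
  hist_row : forall v a, v \in V -> (\sum_(b <- B) h v a b)%N = n v;
  hist_col : forall v b, v \in V -> (\sum_(a : finsupp v) h v a b <= n v)%N;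
  hist_eval : forall b,
    x b = \sum_(v <- V) \sum_(a : finsupp v) v (val a) *+ h v a b }.

(** [h w a b] counts the indices [i] with [v i = w] and [theta i b = a]. Every [i] with [v i = w]
    contributes exactly once to each row, as [theta i] is bijective, and at most once to each
    column; so the row sum is the multiplicity of [w]. *)
Lemma permutation_sum_decomposition :
  permutation_sum V x -> exists B h n, hist_decomposition B h n.
Proof.
case=> k [v [theta [vV thetaB xE]]].
have /fin_all_exists[g gP] i :
    exists g, cancel (theta i) g /\ cancel g (theta i).
  by case: (thetaB i) => g; exists g.
pose h (w : dataVector D M) (a : finsupp w) (b : D) :=
  (\sum_(i < k) ((v i == w) && (theta i b == val a)))%N.
exists (\bigcup_(i <- index_enum 'I_k) [fset g i a | a in finsupp (v i)]), h.
exists (fun w => \sum_(i < k) (v i == w))%N; split.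
- move=> w a b wV bB; apply: big1 => i _; apply/eqP; rewrite eqb0.
  apply: contra bB => /andP[/eqP vw /eqP ba].
  apply/bigfcupP; exists i; rewrite ?mem_index_enum //.
  apply/imfsetP; exists (val a); first by rewrite vw /=; apply: valP.
  by rewrite -ba (gP i).1.
- move=> w a wV; rewrite exchange_big /=; apply: eq_bigr => i _.
  case: eqP => [vw|_] /=; last by rewrite big1.
  rewrite (big_fsetD1 (g i (val a))) /=; last first.
    apply/bigfcupP; exists i; rewrite ?mem_index_enum //.
    by apply/imfsetP; exists (val a) => //=; rewrite vw; apply: valP.
  rewrite (gP i).2 eqxx big_seq big1 // => b; rewrite !inE => /andP[ba _].
  by apply/eqP; rewrite eqb0; apply: contra ba => /eqP <-; rewrite (gP i).1.
- move=> w b wV; rewrite exchange_big /=; apply: leq_sum => i _.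
  case: eqP => [_|_] /=; last by rewrite big1.
  case: (boolP (theta i b \in finsupp w)) => [iw|iw].
    rewrite (bigD1 [` iw]) //= eqxx big1 // => a; apply: contraNeq => /=.
    by rewrite eqb0 negbK => /eqP ba; apply/eqP/val_inj.
  rewrite big1 // => a _; apply/eqP; rewrite eqb0; apply: contra iw => /eqP ->.
  exact: valP.
- move=> b; rewrite xE.
  under [RHS]eq_bigr => w _ do (under eq_bigr => a _ do rewrite -sumrMnr;
    rewrite exchange_big).
  (* For fixed [i], only [w = v i] and [a = theta i b] can contribute; if [theta i b] is outside the
     support, both sides are 0. *)
  rewrite exchange_big /=; apply: eq_bigr => i _.
  rewrite (big_fsetD1 (v i)) //= [X in _ + X]big_seq [X in _ + X]big1 ?addr0.
    case: (boolP (theta i b \in finsupp (v i))) => [iw|iw].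
      rewrite (bigD1 [` iw]) //= !eqxx big1 ?addr0 // => a.
      case: (theta i b =P val a) => [ba|]; last by rewrite andbF.
      by case/eqP; apply: val_inj.
    rewrite (fsfun_dflt iw) big1 // => a _.
    case: (theta i b =P val a) => [ba|]; last by rewrite andbF.
    by case/negP: iw; rewrite ba; apply: valP.
  move=> w; rewrite !inE eq_sym => /andP[/negPf vw _].
  by rewrite big1 // => a _; rewrite vw.
Qed.

(** Column [c] is added to column [b] and then cleared. Row sums do not change, and column [b] now
    evaluates to [x b + x c], which is 0 as is [x b]. *)
Lemma merge_columns B h n b c :
  hist_decomposition B h n ->
  b \in B `\` finsupp x -> c \in B `\` finsupp x -> b != c ->
  {in V, forall v : dataVector D M,
    (\sum_(a : finsupp v) h v a b + \sum_(a : finsupp v) h v a c <= n v)%N} ->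
  exists h', hist_decomposition (B `\ c) h' n.
Proof.
move=> [hout hrow hcol heval]; rewrite !inE => /andP[xb bB] /andP[xc cB] bc le_n.
exists (fun v a d => if d == b then (h v a b + h v a c)%N
                     else if d == c then 0%N else h v a d); split.
- move=> v a d vV; rewrite !inE negb_and negbK.
  case: (d =P b) => [->|_]; first by rewrite (negPf bc) bB.
  by case: (d =P c) => //= _; apply: hout.
- move=> v a vV; rewrite -(hrow v a vV).
  rewrite [RHS](big_fsetD1 c) //= (big_fsetD1 b) /= ?inE ?bc //.
  rewrite [in RHS](big_fsetD1 b) /= ?inE ?bc // eqxx addnA [(h v a c + _)%N]addnC.
  congr (_ + _)%N; rewrite !big_seq; apply: eq_bigr => d; rewrite !inE.
  by case/and3P => /negPf -> /negPf ->.
- move=> v d vV; case: eqP => _; first by rewrite big_split le_n.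
  by case: eqP => _; [rewrite big1 | apply: hcol].
- move=> d; case: eqP => [->|_].
    under eq_bigr => v _ do (under eq_bigr => a _ do rewrite mulrnDr;
      rewrite big_split /=).
    by rewrite big_split /= -!heval !fsfun_dflt // addr0.
  case: eqP => [->|_]; last exact: heval.
  by rewrite fsfun_dflt // big1 // => v _; rewrite big1.
Qed.

Lemma finsupp_eq0 (v : dataVector D M) : (finsupp v == fset0) = (v == [fsfun]).
Proof.
apply/eqP/eqP => [v0|->]; last exact: finsupp0.
by apply/fsfunP => a; rewrite fsfun0E fsfun_dflt // v0 inE.
Qed.

Lemma finsupp_elt_neq0 (v : dataVector D M) : finsupp v -> v != [fsfun].
Proof. by case=> a; apply: contraTneq => ->; rewrite finsupp0 inE. Qed.

(** Induction on the size of [B]: as long as the bound fails, two columns outside the support of [x]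
    can be merged, which removes one element of [B]. *)
Lemma small_decomposition B h n :
  hist_decomposition B h n ->
  exists B' h' n', hist_decomposition B' h' n' /\
    (#|` B'| <= #|` finsupp x|
       + \sum_(v <- V `\ [fsfun]) (2 * #|` finsupp v|).-1)%N.
Proof.
have [V0|[w wV]] := fset_0Vmem (V `\ [fsfun]).
  (* Without nonzero vectors in [V] there are no rows at all, so [B'] can be empty. *)
  move=> [_ _ _ heval].
  have supp0 (v : dataVector D M) : v \in V -> finsupp v -> False.
    move=> vV a; have : v \in V `\ [fsfun] by rewrite !inE vV finsupp_elt_neq0.
    by rewrite V0 inE.
  exists fset0, h, n; split; last by rewrite cardfs0.
  split=> [v a b vV|v a vV|v b vV|//]; try by case: (supp0 v vV a).
  by rewrite big1 // => a; case: (supp0 v vV a).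
have [k] := ubnP #|` B|; elim: k B h => // k IH B h ltB dec.
have [leB|ltC] := leqP #|` B| (#|` finsupp x|
       + \sum_(v <- V `\ [fsfun]) (2 * #|` finsupp v|).-1)%N.
  by exists B, h, n.
have subC : B `\` finsupp x `<=` B by apply/fsubsetP => b; rewrite inE => /andP[].
have [] := @exists_mergeable _ _ (V `\ [fsfun]) (B `\` finsupp x)
    (fun v => #|` finsupp v|) n
    (fun v b => \sum_(a : finsupp v) h v a b)%N.
- by have : w \in enum_fset (V `\ [fsfun]) := wV; case: (enum_fset _).
- by move=> v; rewrite !inE cardfs_gt0 finsupp_eq0 => /andP[].
- move=> v; rewrite !inE => /andP[_ vV].
  apply: (@leq_trans (\sum_(b <- B) \sum_(a : finsupp v) h v a b)%N).
    rewrite [X in (_ <= X)%N](big_fsetID _ (mem (finsupp x))) /=.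
    rewrite (_ : [fset _ | _ in _ & _ \notin _] = B `\` finsupp x) ?leq_addl //.
    by apply/fsetP => b; rewrite !inE /= andbC.
  (* Double counting: the columns over [B] add up to the row sums, [n v] for each element of the
     support. *)
  rewrite exchange_big /= (eq_bigr (fun=> n v)); last first.
    by move=> a _; apply: (hist_row _ _ _ dec).
  by rewrite sum_nat_const -cardfE.
- rewrite cardfsD.
  apply: leq_trans (leq_sub2l _ (fsubset_leq_card (fsubsetIr B (finsupp x)))).
  by rewrite ltn_subRL.
move=> b [c [bC cC bc le_n]].
have [h' dec'] : exists h', hist_decomposition (B `\ c) h' n.
  apply: (merge_columns _ _ _ _ _ dec bC cC bc) => v vV.
  (* The zero vector has no rows, so its columns sum to 0 and never block a merge. *)
  have [v0|v0] := eqVneq v [fsfun]; last by apply: le_n; rewrite !inE v0.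
  by rewrite !big1 // => a; case/eqP: (finsupp_elt_neq0 v a).
apply: IH dec'; move: ltB.
by rewrite (cardfsD1 c B) (fsubsetP subC c cC) add1n ltnS.
Qed.

End Decomposition.

(** Truncating [h v] to the finite set of pairs with column in [B] gives it finite support and, for
    [v] in [V], changes no value. *)
Lemma decomposition_histograms (D : countType) (M : nmodType)
    (V : {fset dataVector D M}) (x : dataVector D M) B h n :
  hist_decomposition V x B h n ->
  exists H : forall v : dataVector D M, histFun (finsupp v) D,
    [/\ forall v, v \in V -> is_histogram (H v),
        forall b, x b = \sum_(v <- V) eval (H v) b
      & forall v, v \in V -> hist_supp (H v) `<=` B].
Proof.
move=> [hout hrow hcol heval].
pose H (v : dataVector D M) : histFun (finsupp v) D :=
  [fsfun p in seq_fset tt [seq (a, b) | a <- enum {: finsupp v}, b <- B]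
     => h v p.1 p.2 | 0%N].
have HE v a b : v \in V -> H v (a, b) = h v a b.
  move=> vV; rewrite fsfunE seq_fsetE /=.
  case: ifPn => //; case: (boolP (b \in B)) => [bB|bB]; last by rewrite hout.
  by rewrite allpairs_f ?mem_enum.
have colE v b : v \in V ->
    col_sum (H v) b = (\sum_(a : finsupp v) h v a b)%N.
  by move=> vV; apply: eq_bigr => a _; rewrite HE.
exists H; split.
- move=> v vV; exists (n v); split=> [a|b]; last by rewrite colE ?hcol.
  rewrite (@row_sumE _ _ _ _ B); last by move=> b bB; rewrite HE ?hout.
  by rewrite -(hrow v a vV); apply: eq_bigr => b _; rewrite HE.
- move=> b; rewrite heval !big_seq; apply: eq_bigr => v vV.
  by apply: eq_bigr => a _; rewrite HE.
- move=> v vV; apply/fsubsetP => b; rewrite in_hist_supp colE //.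
  by apply: contraLR => bB; rewrite -leqNgt big1 // => a _; rewrite hout.
Qed.

(* The bound is an inequality in int, since 2|supp v| - 1 = -1 for
   the zero vector. *)
Theorem theorem7 (D : countType) (M : nmodType)
    (V : {fset dataVector D M}) (x : dataVector D M) :
  permutation_sum V x ->
  exists H : forall v : dataVector D M, histFun (finsupp v) D,
    [/\ forall v, v \in V -> is_histogram (H v),
        forall b, x b = \sum_(v <- V) eval (H v) b
      & (#|` \bigcup_(v <- V) hist_supp (H v) |)%:Z
          <= (#|` finsupp x |)%:Z + 1
             + \sum_(v <- V) (2 * (#|` finsupp v |)%:Z - 1)].
Proof.
case/permutation_sum_decomposition => B0 [h0 [n0 /small_decomposition]].
case=> B [h [n [/decomposition_histograms[H [Hhist Heval HB]] leB]]].
exists H; split=> //.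
have leU : (#|` \bigcup_(v <- V) hist_supp (H v)| <= #|` B|)%N.
  apply/fsubset_leq_card/bigfcupsP => v vV _; exact: HB.
(* On nonzero vectors the predecessor does not truncate, so the natural and integer sums agree. *)
have nzE : \sum_(v <- V `\ [fsfun]) (2 * (#|` finsupp v|)%:Z - 1)
    = (\sum_(v <- V `\ [fsfun]) (2 * #|` finsupp v|).-1)%N%:Z.
  rewrite -natz natr_sum !big_seq; apply: eq_bigr => v.
  rewrite !inE -finsupp_eq0 -cardfs_gt0 [in RHS]natz.
  by case: #|` _| => // s _; lia.
move: (leq_trans leU leB); rewrite -lez_nat PoszD -nzE => /le_trans; apply.
(* If the zero vector lies in [V], its term -1 cancels the [+ 1] of the bound; otherwise the [+ 1]
   is slack. *)
rewrite -addrA lerD2l; have [zV|zV] := boolP ([fsfun] \in V).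
  rewrite [X in 1 + X](big_fsetD1 _ zV) /= finsupp0 cardfs0.
  by rewrite mulr0 add0r addrA subrr add0r.
by rewrite mem_fsetD1 // lerDr.
Qed.
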